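(* Let $\alpha\neq\beta$, $S$ and $P$ be constants, and let $f(y),k(y)$ be smooth nonvanishing real functions on a real interval. If $f$ and $k$ satisfy the differential condition $$\frac{d}{dy}\left[\left(\frac{f(y)}{k(y)}\right)^{\frac{1}{\beta-\alpha}}\right]=SP^{\beta-1}f(y)\left[\frac{f(y)}{k(y)}\right]^{\frac{\alpha}{\beta-\alpha}},$$ or $$\frac{d}{dy}\left[\left(\frac{f(y)}{k(y)}\right)^{\frac{1}{\beta-\alpha}}\right]=SP^{\beta-1}k(y)\left[\frac{f(y)}{k(y)}\right]^{\frac{\beta}{\beta-\alpha}},$$ then the generalized Abel equation $$\frac{dv}{dy}=f(y)v^{\alpha}+k(y)v^{\beta}$$ is exactly integrable.
   Context: A differential equation is called (exactly) integrable if it can be solved by quadratures, i.e. its general solution can be expressed (possibly implicitly) by means of definite or indefinite integrals. It is understood that the real powers appearing are defined, e.g. $P>0$, $f/k>0$ and $v>0$ when the exponents are not integers. *)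

(* Defs.v *)
From Stdlib Require Import Reals List.
From Coquelicot Require Import Coquelicot.
Open Scope R_scope.

(** ** Calculus on an interval *)

Definition interval (I : R -> Prop) : Prop :=
  (forall x y z, I x -> I z -> x <= y <= z -> I y) /\
  (exists a b, I a /\ I b /\ a < b).

(** [D_in] is the derivative relative to the set: one-sided at an endpoint
    belonging to the interval. *)
Definition differentiable_on (I : R -> Prop) (g : R -> R) : Prop :=
  exists g', forall y, I y -> D_in g g' I y.

Definition smooth_on (I : R -> Prop) (g : R -> R) : Prop :=
  exists G : nat -> R -> R,
    (forall y, I y -> G O y = g y) /\
    (forall n y, I y -> D_in (G n) (G (S n)) I y).

(** ** Real powers *)

Definition pow_defined (x a : R) : Prop :=
  0 < x \/ (exists z : Z, a = IZR z /\ (x <> 0 \/ (0 <= z)%Z)).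

(** Meaningful only under [pow_defined x a]; then for [x <= 0] the exponent is
    an integer, equal to its integer part. In particular [rpow 0 0 = 1]. *)
Definition rpow (x a : R) : R :=
  if Rlt_dec 0 x then Rpower x a else powerRZ x (Int_part a).

(** ** Formulas in quadratures *)

(** Variables are de Bruijn indices; [QInt a b e] is the integral from [a] to
    [b] of [e], whose variable [0] is the variable of integration. [QCoef i e]
    applies the [i]-th given coefficient function to [e]. *)
Inductive qexp : Type :=
| QVar (n : nat)
| QConst (c : R)
| QCoef (i : nat) (e : qexp)
| QAdd (e1 e2 : qexp)
| QMul (e1 e2 : qexp)
| QInv (e : qexp)
| QPow (e : qexp) (a : R)
| QExp (e : qexp)
| QLn (e : qexp)
| QSin (e : qexp)
| QCos (e : qexp)
| QInt (a b e : qexp).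

Definition env_cons (t : R) (rho : nat -> R) (n : nat) : R :=
  match n with O => t | S m => rho m end.

(** [qdenotes I K e rho x]: the formula [e] is defined at [rho] and has value
    [x], where the coefficient functions [K] are only known on [I]. *)
Fixpoint qdenotes (I : R -> Prop) (K : list (R -> R)) (e : qexp)
    (rho : nat -> R) (x : R) {struct e} : Prop :=
  match e with
  | QVar n => x = rho n
  | QConst c => x = c
  | QCoef i e1 => exists g x1, nth_error K i = Some g /\
      qdenotes I K e1 rho x1 /\ I x1 /\ x = g x1
  | QAdd e1 e2 => exists x1 x2,
      qdenotes I K e1 rho x1 /\ qdenotes I K e2 rho x2 /\ x = x1 + x2
  | QMul e1 e2 => exists x1 x2,
      qdenotes I K e1 rho x1 /\ qdenotes I K e2 rho x2 /\ x = x1 * x2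
  | QInv e1 => exists x1, qdenotes I K e1 rho x1 /\ x1 <> 0 /\ x = / x1
  | QPow e1 a => exists x1,
      qdenotes I K e1 rho x1 /\ pow_defined x1 a /\ x = rpow x1 a
  | QExp e1 => exists x1, qdenotes I K e1 rho x1 /\ x = exp x1
  | QLn e1 => exists x1, qdenotes I K e1 rho x1 /\ 0 < x1 /\ x = ln x1
  | QSin e1 => exists x1, qdenotes I K e1 rho x1 /\ x = sin x1
  | QCos e1 => exists x1, qdenotes I K e1 rho x1 /\ x = cos x1
  | QInt a b e1 => exists xa xb h,
      qdenotes I K a rho xa /\ qdenotes I K b rho xb /\
      (forall t, Rmin xa xb <= t <= Rmax xa xb ->
         qdenotes I K e1 (env_cons t rho) (h t)) /\
      is_RInt h xa xb x
  end.

(** ** First-order equations solvable by quadratures *)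

(** [v] solves [dv/dy = F y v] on [J], where [F y v] makes sense when
    [D y v]. *)
Definition is_solution (D : R -> R -> Prop) (F : R -> R -> R)
    (J : R -> Prop) (v : R -> R) : Prop :=
  forall y, J y -> D y (v y) /\ D_in v (fun z => F z (v z)) J y.

(** The general solution of [dv/dy = F y v] is given, implicitly, by finitely
    many formulas in quadratures [E(y, v, C) = 0] with one arbitrary constant
    [C]: the differentiable functions satisfying one of these relations are
    exactly the solutions. Several formulas are allowed because an indefinite
    integral such as that of [1 / q] requires one base point on each interval
    where [q] does not vanish, and the zeros of [q] give exceptional
    solutions. *)
Definition exactly_integrable (I : R -> Prop) (K : list (R -> R))
    (D : R -> R -> Prop) (F : R -> R -> R) : Prop :=
  exists L : list qexp,
    forall (J : R -> Prop) (v : R -> R),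
      interval J -> (forall y, J y -> I y) -> differentiable_on J v ->
      (is_solution D F J v <->
       exists E C, In E L /\
         forall y, J y ->
           qdenotes I K E (env_cons y (env_cons (v y) (fun _ => C))) 0).

(* Main.v *)
(** With [u = |f / k|^(1 / (beta - alpha))] and [e] the (constant) sign of
    [f / k], the hypothesis reads [u' = c f u^alpha] for some constant [c], so
    that [v = u w] turns the equation into the separable one
    [w' = g(y) q(w)], with [g = f u^(alpha - 1)] and
    [q(w) = w^alpha + e w^beta - c w]. By Rolle's theorem [q] has finitely many
    zeros; these are the equilibria of [w], which no other solution can meet. The
    remaining points of the domain of [q] form finitely many intervals, and on the
    one with base point [b] the solutions are given by
    [int_b^w dt / q(t) = int_a^y g(s) ds + C]. *)

Require Import Defs.
From Stdlib Require Import Reals List Lra Classical.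
From Coquelicot Require Import Coquelicot.
Import ListNotations.
Open Scope R_scope.

(** * Calculus relative to a set of reals *)

(** The two alternatives of the hypothesis are one condition: [u^(beta - alpha) = e f / k] gives
    [k u^beta = e f u^alpha], so passing from one to the other only changes the constant [c].
    Solutions may vanish or be negative when the exponents allow it, so the substitution rests on
    homogeneity of powers under the positive factor [u], not on [v > 0]. The domain of [q] is then
    the positive half-line, the line without [0], or the whole line, and only [0] and the zeros of
    [q] can cut it into pieces. Uniqueness at an equilibrium could fail where [q] is not
    differentiable, as for a square root at [0]; but a noninteger power is not defined at [0], so
    [q] is differentiable wherever it is defined. The list of formulas has to be fixed before the
    interval [J] and the function [v] are known, which is why finiteness of the zeros and of the
    components matters. Since [J] may contain its endpoints, the mean value, intermediate value and
    fundamental theorems are needed for derivatives relative to a set. *)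

(** [D_in] evaluates its derivative function only at [y], so a constant function can carry the
    single value [l]. *)
Definition has_deriv (J : R -> Prop) (g : R -> R) (y l : R) : Prop :=
  D_in g (fun _ => l) J y.

Definition cont_in (J : R -> Prop) (g : R -> R) (y : R) : Prop :=
  filterlim g (within J (locally y)) (locally (g y)).

Definition convex (J : R -> Prop) : Prop :=
  forall x y z, J x -> J z -> x <= y <= z -> J y.

Definition between (a b t : R) : Prop := Rmin a b <= t <= Rmax a b.

Ltac minmax := unfold between, Rmin, Rmax in *; repeat destruct Rle_dec; try lra.

Lemma convex_between (J : R -> Prop) (a b t : R) :
  convex J -> J a -> J b -> between a b t -> J t.
Proof.
  intros HJ Ha Hb Ht; minmax.
  - now apply (HJ a t b).
  - now apply (HJ b t a); try lra.
Qed.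

Lemma cont_in_iff (J : R -> Prop) (g : R -> R) (y : R) :
  cont_in J g y <->
  forall eps, 0 < eps -> exists d, 0 < d /\
    forall x, J x -> Rabs (x - y) < d -> Rabs (g x - g y) < eps.
Proof.
  split.
  - intros H eps He.
    destruct (proj1 (filterlim_locally g (g y)) H (mkposreal eps He)) as [d Hd].
    exists d; split; [apply cond_pos|].
    intros x Jx Hx; exact (Hd x Hx Jx).
  - intros H; apply filterlim_locally; intros eps.
    destruct (H eps (cond_pos eps)) as [d [Hd Hx]].
    exists (mkposreal d Hd); intros x Bx Jx; exact (Hx x Jx Bx).
Qed.

Lemma cont_in_deriv (J : R -> Prop) (g : R -> R) (y l : R) :
  has_deriv J g y l -> cont_in J g y.
Proof.
  intros H; apply cont_in_iff; intros eps He.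
  destruct (cont_deriv _ _ _ _ H eps He) as [d [Hd Hx]].
  exists d; split; [exact Hd|]; intros x Jx Hxy.
  destruct (Req_dec y x) as [<-|Hne].
  - rewrite Rminus_diag; rewrite Rabs_R0; exact He.
  - exact (Hx x (conj (conj Jx Hne) Hxy)).
Qed.

Lemma cont_in_comp (J : R -> Prop) (g h : R -> R) (y : R) :
  cont_in J g y -> continuous h (g y) -> cont_in J (fun x => h (g x)) y.
Proof. intros Hg Hh; exact (filterlim_comp _ _ _ _ _ _ _ _ Hg Hh). Qed.

Lemma cont_in_mult (J : R -> Prop) (g h : R -> R) (y : R) :
  cont_in J g y -> cont_in J h y -> cont_in J (fun x => g x * h x) y.
Proof.
  intros Hg Hh.
  exact (filterlim_comp_2 _ _ _ Hg Hh (filterlim_mult (K := R_AbsRing) _ _)).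
Qed.

Lemma cont_in_continuous (J : R -> Prop) (g : R -> R) (y : R) :
  continuous g y -> cont_in J g y.
Proof.
  intros Hg; exact (filterlim_filter_le_1 _ (filter_le_within (F := locally y) J) Hg).
Qed.

Definition clamp (a b t : R) : R := Rmax a (Rmin t b).

Lemma clamp_id (a b t : R) : a <= t <= b -> clamp a b t = t.
Proof. unfold clamp; minmax. Qed.

Lemma clamp_in (a b t : R) : a <= b -> a <= clamp a b t <= b.
Proof. unfold clamp; minmax. Qed.

Lemma clamp_lipschitz (a b s t : R) :
  a <= b -> Rabs (clamp a b s - clamp a b t) <= Rabs (s - t).
Proof. intros Hab; unfold clamp; minmax; unfold Rabs; repeat destruct Rcase_abs; lra. Qed.

(** Clamping the argument turns one-sided continuity at the endpoints of
    [[a, b]] into continuity on the whole line. *)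
Lemma continuous_clamp (J : R -> Prop) (g : R -> R) (a b : R) :
  a <= b -> (forall t, a <= t <= b -> J t /\ cont_in J g t) ->
  forall t, continuous (fun s => g (clamp a b s)) t.
Proof.
  intros Hab Hg t.
  assert (Hc := clamp_in a b t Hab).
  apply filterlim_locally; intros eps.
  destruct (proj1 (cont_in_iff _ _ _) (proj2 (Hg _ Hc)) eps (cond_pos eps)) as [d [Hd Hx]].
  exists (mkposreal d Hd); intros s Hs.
  apply Hx.
  - apply Hg, clamp_in, Hab.
  - eapply Rle_lt_trans; [apply clamp_lipschitz, Hab|exact Hs].
Qed.

Lemma ivt_in (J : R -> Prop) (g : R -> R) (a b z : R) :
  convex J -> J a -> J b -> (forall t, J t -> cont_in J g t) ->
  between (g a) (g b) z -> exists t, J t /\ g t = z.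
Proof.
  intros HJ Ja Jb Hg Hz.
  assert (Hsub : forall t, Rmin a b <= t <= Rmax a b -> J t /\ cont_in J g t).
  { intros t Ht; assert (Jt : J t) by now apply (convex_between J a b). auto. }
  assert (Hle : Rmin a b <= Rmax a b) by minmax.
  destruct (IVT_gen (fun s => g (clamp (Rmin a b) (Rmax a b) s)) a b z) as [t [Ht Hgt]].
  - intros t; apply continuity_pt_filterlim; now apply (continuous_clamp J).
  - rewrite !clamp_id by minmax; exact Hz.
  - exists (clamp (Rmin a b) (Rmax a b) t); split; [|exact Hgt].
    apply Hsub, clamp_in, Hle.
Qed.

Lemma has_deriv_ext (J : R -> Prop) (g h : R -> R) (y l : R) :
  (forall x, J x -> g x = h x) -> J y -> has_deriv J g y l -> has_deriv J h y l.
Proof.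
  intros E Jy H eps He; destruct (H eps He) as [d [Hd Hx]].
  exists d; split; [exact Hd|]; intros x Hx'.
  rewrite <- (E y Jy), <- (E x (proj1 (proj1 Hx'))); now apply Hx.
Qed.

Lemma has_deriv_sub (J K : R -> Prop) (g : R -> R) (y l : R) :
  (forall x, J x -> K x) -> has_deriv K g y l -> has_deriv J g y l.
Proof.
  intros Hs H eps He; destruct (H eps He) as [d [Hd Hx]].
  exists d; split; [exact Hd|]; intros x [[Jx Hne] Hxy].
  apply Hx; repeat split; auto.
Qed.

Lemma has_deriv_eq (J : R -> Prop) (g : R -> R) (y l l' : R) :
  l = l' -> has_deriv J g y l -> has_deriv J g y l'.
Proof. now intros ->. Qed.

Lemma has_deriv_const (J : R -> Prop) (c y : R) : has_deriv J (fun _ => c) y 0.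
Proof. apply Dconst. Qed.

Lemma has_deriv_plus (J : R -> Prop) (g h : R -> R) (y l m : R) :
  has_deriv J g y l -> has_deriv J h y m ->
  has_deriv J (fun x => g x + h x) y (l + m).
Proof. apply Dadd. Qed.

Lemma has_deriv_minus (J : R -> Prop) (g h : R -> R) (y l m : R) :
  has_deriv J g y l -> has_deriv J h y m ->
  has_deriv J (fun x => g x - h x) y (l - m).
Proof. apply Dminus. Qed.

Lemma has_deriv_mult (J : R -> Prop) (g h : R -> R) (y l m : R) :
  has_deriv J g y l -> has_deriv J h y m ->
  has_deriv J (fun x => g x * h x) y (l * h y + g y * m).
Proof. apply (Dmult J (fun _ => l) (fun _ => m)). Qed.

Lemma has_deriv_comp (J K : R -> Prop) (g h : R -> R) (y l m : R) :
  (forall x, J x -> K (g x)) -> has_deriv J g y l -> has_deriv K h (g y) m ->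
  has_deriv J (fun x => h (g x)) y (l * m).
Proof.
  intros HK Hg Hh.
  apply (has_deriv_sub _ (Dgf J K g)).
  - intros x Jx; split; auto.
  - exact (Dcomp J K (fun _ => l) (fun _ => m) g h y Hg Hh).
Qed.

Lemma has_deriv_derive (J : R -> Prop) (h : R -> R) (y l : R) :
  is_derive h y l -> has_deriv J h y l.
Proof.
  intros H; apply is_derive_Reals in H.
  apply (has_deriv_sub _ no_cond); [easy|].
  now apply (proj2 (derivable_pt_lim_D_in h (fun _ => l) y)).
Qed.

Lemma has_deriv_comp_derive (J : R -> Prop) (g h : R -> R) (y l m : R) :
  has_deriv J g y l -> is_derive h (g y) m ->
  has_deriv J (fun x => h (g x)) y (l * m).
Proof.
  intros Hg Hh; apply (has_deriv_comp _ (fun _ => True)); auto.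
  now apply has_deriv_derive.
Qed.

Lemma has_deriv_div (J : R -> Prop) (g h : R -> R) (y l m : R) :
  h y <> 0 -> has_deriv J g y l -> has_deriv J h y m ->
  has_deriv J (fun x => g x / h x) y (l / h y - g y * m / (h y)²).
Proof.
  intros H0 Hg Hh.
  assert (Hi : is_derive Rinv (h y) (- / (h y)²)).
  { auto_derive; [easy|unfold Rsqr; field; easy]. }
  eapply has_deriv_eq;
    [|exact (has_deriv_mult _ _ _ _ _ _ Hg (has_deriv_comp_derive _ _ _ _ _ _ Hh Hi))].
  unfold Rsqr; field; exact H0.
Qed.

(** A nondegenerate interval accumulates at each of its points, endpoints included; the witnesses
    lie between [y] and another point [c] of [J], within [e / 2] of [y]. *)
Lemma has_deriv_unique (J : R -> Prop) (g : R -> R) (y l m : R) :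
  interval J -> J y -> has_deriv J g y l -> has_deriv J g y m -> l = m.
Proof.
  intros [HJ [a [b [Ja [Jb Hab]]]]] Jy.
  apply single_limit; intros e He.
  assert (exists c, J c /\ c <> y) as [c [Jc Hc]].
  { destruct (Req_dec a y) as [<-|]; [exists b; split; [easy|lra]|exists a; auto]. }
  destruct (Rtotal_order c y) as [H|[H|H]]; [|easy|].
  - assert (Hm : c <= Rmax c (y - e / 2) < y /\ y - e / 2 <= Rmax c (y - e / 2)) by minmax.
    exists (Rmax c (y - e / 2)); split; [split|].
    + now apply (HJ c _ y); try lra.
    + lra.
    + unfold Rdist, Rabs; destruct Rcase_abs; lra.
  - assert (Hm : y < Rmin c (y + e / 2) <= c /\ Rmin c (y + e / 2) <= y + e / 2) by minmax.
    exists (Rmin c (y + e / 2)); split; [split|].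
    + now apply (HJ y _ c); try lra.
    + lra.
    + unfold Rdist, Rabs; destruct Rcase_abs; lra.
Qed.

Lemma is_derive_of_has_deriv (J : R -> Prop) (g h : R -> R) (a b y l : R) :
  a < y < b -> (forall x, a < x < b -> J x /\ g x = h x) ->
  has_deriv J g y l -> is_derive h y l.
Proof.
  intros Hy Hab H.
  apply is_derive_Reals, (proj1 (derivable_pt_lim_D_in h (fun _ => l) y)).
  intros eps He; destruct (H eps He) as [d [Hd Hx]].
  set (d' := Rmin d (Rmin (y - a) (b - y))).
  assert (Hd' : 0 < d' <= d /\ d' <= y - a /\ d' <= b - y) by (unfold d'; minmax).
  exists d'; split; [tauto|]; intros x [[_ Hne] Hxy].
  simpl in Hxy; unfold Rdist in Hxy.
  assert (Hx' : a < x < b) by (revert Hxy; unfold Rabs; destruct Rcase_abs; lra).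
  rewrite <- (proj2 (Hab x Hx')), <- (proj2 (Hab y Hy)).
  apply Hx; repeat split; [now apply Hab|exact Hne|].
  simpl; unfold Rdist; lra.
Qed.

(** The mean value theorem applies to the clamped function, which is continuous on the whole line
    and has an ordinary derivative strictly inside [[a, b]]. *)
Lemma has_deriv_zero_const (J : R -> Prop) (h : R -> R) :
  convex J -> (forall y, J y -> has_deriv J h y 0) ->
  forall a b, J a -> J b -> h a = h b.
Proof.
  intros HJ H.
  assert (Hlt : forall a b, J a -> J b -> a < b -> h a = h b).
  { intros a b Ja Jb Hab.
    assert (Hin : forall t, a <= t <= b -> J t) by (intros t Ht; now apply (HJ a t b)).
    destruct (MVT_gen (fun s => h (clamp a b s)) a b (fun _ => 0)) as [c [_ Hc]].
    - rewrite Rmin_left, Rmax_right by lra; intros x Hx.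
      apply (is_derive_of_has_deriv J h _ a b); [lra| |apply H, Hin; lra].
      intros t Ht; rewrite clamp_id by lra; split; [apply Hin; lra|reflexivity].
    - intros x _; apply continuity_pt_filterlim, (continuous_clamp J); [lra|].
      intros t Ht; split; [auto|]; eapply cont_in_deriv, H; auto.
    - rewrite !clamp_id in Hc by lra; lra. }
  intros a b Ja Jb; destruct (Rtotal_order a b) as [L|[->|L]]; auto.
  symmetry; auto.
Qed.

Lemma is_RInt_cont_in (J : R -> Prop) (g : R -> R) (a b : R) :
  convex J -> (forall t, J t -> cont_in J g t) -> J a -> J b ->
  is_RInt g a b (RInt g a b).
Proof.
  intros HJ Hg Ja Jb; apply (RInt_correct g).
  apply (ex_RInt_ext (fun s => g (clamp (Rmin a b) (Rmax a b) s))).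
  - intros x Hx; rewrite clamp_id; [reflexivity|lra].
  - apply (ex_RInt_continuous (V := R_CompleteNormedModule)); intros z _.
    apply (continuous_clamp J); [minmax|].
    intros t Ht; assert (J t) by now apply (convex_between J a b). auto.
Qed.

Lemma has_deriv_RInt (J : R -> Prop) (g : R -> R) (a y : R) :
  convex J -> (forall t, J t -> cont_in J g t) -> J a -> J y ->
  has_deriv J (fun x => RInt g a x) y (g y).
Proof.
  intros HJ Hg Ja Jy eps He.
  destruct (proj1 (cont_in_iff _ _ _) (Hg y Jy) (eps / 2)) as [d [Hd Hx]]; [lra|].
  exists d; split; [exact Hd|]; intros x [[Jx Hne] Hxy]; simpl in *; unfold Rdist in *.
  assert (Hay := is_RInt_cont_in J g a y HJ Hg Ja Jy).
  assert (Hyx := is_RInt_cont_in J g y x HJ Hg Jy Jx).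
  assert (Hax : RInt g a x = RInt g a y + RInt g y x)
    by exact (is_RInt_unique _ _ _ _ (is_RInt_Chasles _ _ _ _ _ _ Hay Hyx)).
  (* The integral of [g t - g y] from [y] to [x] is small by continuity at [y]; [eps / 2] leaves
     room for the strict inequality at the end. *)
  assert (Hn : Rabs (RInt g y x - (x - y) * g y) <= Rabs (x - y) * (eps / 2)).
  { apply (norm_RInt_le_const_abs (fun t => g t - g y) y x).
    - intros t Ht; apply Rlt_le, Hx; [now apply (convex_between J y x)|].
      eapply Rle_lt_trans; [|exact Hxy].
      revert Ht; minmax; unfold Rabs; repeat destruct Rcase_abs; lra.
    - exact (is_RInt_minus _ _ _ _ _ _ Hyx (is_RInt_const y x (g y))). }
  assert (Hp : 0 < Rabs (x - y)) by (apply Rabs_pos_lt; lra).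
  replace ((RInt g a x - RInt g a y) / (x - y) - g y)
    with ((RInt g y x - (x - y) * g y) / (x - y)) by (rewrite Hax; field; lra).
  rewrite Rabs_div by lra.
  apply (Rmult_lt_reg_r (Rabs (x - y))); [exact Hp|].
  unfold Rdiv; rewrite Rmult_assoc, Rinv_l by lra.
  nra.
Qed.

(** * Separable equations *)

(** Since [q z = 0], the quotient is the difference quotient of [q] at [z], so continuity at [z] is
    differentiability itself; no continuity of [q'] is involved. *)
Lemma slope_continuous (q : R -> R) (z t : R) :
  ex_derive q z -> ex_derive q t -> q z = 0 ->
  continuous (fun s => if Req_EM_T s z then Derive q z else q s / (s - z)) t.
Proof.
  intros Hz Ht H0; destruct (Req_dec t z) as [->|Hne].
  - apply filterlim_locally; intros eps.
    apply Derive_correct, is_derive_Reals in Hz.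
    destruct (Hz eps (cond_pos eps)) as [d Hd].
    exists d; intros s Hs; simpl in s.
    destruct (Req_EM_T z z) as [_|]; [|easy].
    destruct (Req_EM_T s z) as [_|Hsz]; [apply ball_center|].
    specialize (Hd (s - z)).
    replace (z + (s - z)) with (s : R) in Hd by (unfold Rminus; ring).
    rewrite H0, Rminus_0_r in Hd.
    apply Hd; [lra|exact Hs].
  - apply (continuous_ext_loc _ (fun s => q s / (s - z))).
    + apply (filter_imp (fun s => s <> z)).
      * intros s Hs; destruct (Req_EM_T s z); easy.
      * apply open_neq; exact Hne.
    + apply (ex_derive_continuous (V := R_NormedModule)).
      apply ex_derive_div; [exact Ht|auto_derive; easy|lra].
Qed.

(** Near a zero [z] of [q], the difference [w - z] solves the linear equation
    [x' = g r(w) x], where [r] is the slope of [q] at [z]. *)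
Lemma equilibrium_unique (J Dom : R -> Prop) (g q w : R -> R) (a : R) :
  convex J -> (forall t, Dom t -> ex_derive q t) ->
  (forall y, J y -> cont_in J g y) ->
  (forall y, J y -> Dom (w y) /\ has_deriv J w y (g y * q (w y))) ->
  J a -> q (w a) = 0 -> forall y, J y -> w y = w a.
Proof.
  intros HJ Hq Hg Hw Ja H0.
  set (z := w a) in *.
  set (r := fun s => if Req_EM_T s z then Derive q z else q s / (s - z)).
  assert (Hr : forall s, q s = r s * (s - z)).
  { intros s; unfold r; destruct (Req_EM_T s z) as [->|]; [lra|field; lra]. }
  set (m := fun y => g y * r (w y)).
  assert (Hm : forall y, J y -> cont_in J m y).
  { intros y Jy; apply cont_in_mult; [auto|].
    apply (cont_in_comp J w r).
    - eapply cont_in_deriv; apply Hw; exact Jy.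
    - apply slope_continuous; [apply Hq, Hw|apply Hq, Hw|]; easy. }
  (* Integrating factor of the linear equation: [x] is constant and vanishes at [a], while the
     exponential has no zero. *)
  set (x := fun y => (w y - z) * exp (- RInt m a y)).
  assert (Hx : forall y, J y -> has_deriv J x y 0).
  { intros y Jy; destruct (Hw y Jy) as [_ Hd].
    assert (HM := has_deriv_RInt J m a y HJ Hm Ja Jy).
    assert (HE : is_derive (fun u => exp (- u)) (RInt m a y) (- exp (- RInt m a y))).
    { auto_derive; [easy|ring]. }
    eapply has_deriv_eq;
      [|exact (has_deriv_mult _ _ _ _ _ _
                 (has_deriv_minus _ _ _ _ _ _ Hd (has_deriv_const J z y))
                 (has_deriv_comp_derive _ _ _ _ _ _ HM HE))].
    simpl; unfold m; rewrite (Hr (w y)); ring. }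
  intros y Jy.
  assert (E := has_deriv_zero_const J x HJ Hx y a Jy Ja).
  assert (P := exp_pos (- RInt m a y)).
  unfold x in E; fold z in E; nra.
Qed.

(** The points of [A] outside the finite set [Z] fall into finitely many
    classes, two points being equivalent when [Z] does not separate them. *)
Lemma finite_representatives (Z : list R) : forall A : R -> Prop,
  exists B : list R, (forall b, In b B -> A b) /\
    forall t, A t -> ~ In t Z ->
      exists b, In b B /\ forall z, In z Z -> ~ between b t z.
Proof.
  induction Z as [|z Z IH]; intros A.
  - destruct (classic (exists b, A b)) as [[b Hb]|H].
    + exists [b]; split; [intros ? [<-|[]]; exact Hb|].
      intros t _ _; exists b; split; [now left|easy].
    + exists []; split; [easy|]; intros t Ht; destruct H; now exists t.
  - destruct (IH (fun t => A t /\ t < z)) as [B1 [A1 H1]].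
    destruct (IH (fun t => A t /\ z < t)) as [B2 [A2 H2]].
    exists (B1 ++ B2); split.
    + intros b Hb; apply in_app_or in Hb as [Hb|Hb]; [now apply A1|now apply A2].
    + intros t Ht HZ; simpl in HZ.
      destruct (Rtotal_order t z) as [L|[->|L]]; [|tauto|].
      * destruct (H1 t) as [b [Hb Hs]]; [easy|tauto|].
        exists b; split; [apply in_or_app; now left|].
        intros z' [<-|Hz']; [|now apply Hs].
        assert (b < z) by now apply A1. minmax.
      * destruct (H2 t) as [b [Hb Hs]]; [easy|tauto|].
        exists b; split; [apply in_or_app; now right|].
        intros z' [<-|Hz']; [|now apply Hs].
        assert (z < b) by now apply A2. minmax.
Qed.

(** Trims a finite superset to an exact enumeration: every value kept as a zero of [q] will yield an
    equilibrium formula, so spurious ones must go. *)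
Lemma finite_sub (Q : R -> Prop) (l : list R) :
  (forall t, Q t -> In t l) -> exists l', forall t, In t l' <-> Q t.
Proof.
  intros H.
  assert (forall l, exists l', forall t, In t l' <-> In t l /\ Q t) as Hl.
  { clear; induction l as [|x l [l' IH]]; [now exists []|].
    destruct (classic (Q x)) as [Hx|Hx]; [exists (x :: l')|exists l'];
      intros t; simpl; rewrite IH; intuition congruence. }
  destruct (Hl l) as [l' Hl']; exists l'; intros t; rewrite Hl'; firstorder.
Qed.

(** Rolle: between two zeros of [h] that the zeros of [h'] do not separate. *)
Lemma finite_zeros_deriv (h h' : R -> R) (Z : list R) :
  (forall s, is_derive h s (h' s)) -> (forall s, h' s = 0 -> In s Z) ->
  exists L, forall s, h s = 0 -> In s L.
Proof.
  intros Hd HZ.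
  destruct (finite_representatives Z (fun s => h s = 0)) as [B [HB Hsep]].
  (* Each class of zeros of [h] reduces to its representative, so a zero outside [Z] already lies in
     [B]. *)
  exists (B ++ Z); intros s Hs; apply in_or_app.
  destruct (classic (In s Z)) as [|Hn]; [now right|left].
  destruct (Hsep s Hs Hn) as [b [Hb Hno]].
  assert (Hlt : forall x y, h x = 0 -> h y = 0 -> x < y ->
            (forall z, In z Z -> ~ x <= z <= y) -> False).
  { intros x y Hx Hy Hxy Hz.
    destruct (MVT_cor2 h h' x y Hxy) as [c [E Hc]].
    - intros c _; apply is_derive_Reals, Hd.
    - apply (Hz c); [apply HZ; nra|lra]. }
  destruct (Rtotal_order s b) as [L|[->|L]]; [|exact Hb|]; exfalso.
  - apply (Hlt s b); auto; intros z Hz Hc; apply (Hno z Hz); minmax.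
  - apply (Hlt b s); auto; intros z Hz Hc; apply (Hno z Hz); minmax.
Qed.

(** Dividing the derivative by [exp (m * s)] leaves [h1], which has a single exponential. Either
    [h1] is constant or its derivative has no zero, and Rolle leads back to the sum. The case
    [n = m], [b + c = 0] is apart: there the sum is the nonzero constant [a]. *)
Lemma finite_zeros_exp (a b c m n : R) :
  a <> 0 -> b <> 0 -> m <> 0 ->
  exists L, forall s, a + b * exp (m * s) + c * exp (n * s) = 0 -> In s L.
Proof.
  intros Ha Hb Hm.
  set (h1 := fun s => b * m + c * n * exp ((n - m) * s)).
  assert (Hfin : forall Z, (forall s, h1 s = 0 -> In s Z) ->
    exists L, forall s, a + b * exp (m * s) + c * exp (n * s) = 0 -> In s L).
  { intros Z HZ; apply (finite_zeros_deriv _ (fun s => exp (m * s) * h1 s) Z).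
    - intros s; auto_derive; [easy|unfold h1].
      replace (n * s) with (m * s + (n - m) * s) by ring; rewrite exp_plus; ring.
    - intros s Hs; apply HZ; assert (P := exp_pos (m * s)); nra. }
  destruct (Req_dec (c * n) 0) as [E|E].
  - apply (Hfin []); intros s; unfold h1; rewrite E; nra.
  - destruct (Req_dec n m) as [->|Hnm].
    + destruct (Req_dec (b + c) 0) as [E2|E2].
      * exists []; intros s Hs; apply Ha; replace a with
          (a + b * exp (m * s) + c * exp (m * s) - (b + c) * exp (m * s)) by ring.
        rewrite Hs, E2; ring.
      * apply (Hfin []); intros s; unfold h1.
        replace ((m - m) * s) with 0 by ring; rewrite exp_0.
        intros H; destruct E2; nra.
    + destruct (finite_zeros_deriv h1 (fun s => c * n * (n - m) * exp ((n - m) * s)) [])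
        as [Z HZ]; [| |now apply (Hfin Z)].
      * intros s; unfold h1; auto_derive; [easy|ring].
      * intros s Hs; assert (P := exp_pos ((n - m) * s)).
        apply Rmult_integral in Hs as [Hs|Hs]; [|lra].
        apply Rmult_integral in Hs as [Hs|Hs]; [easy|lra].
Qed.

(** Substituting [t = exp s] and dividing by [t^alpha] gives an exponential sum with constant term
    [a]. *)
Lemma finite_zeros_Rpower (a b c alpha beta : R) :
  a <> 0 -> b <> 0 -> alpha <> beta ->
  exists L, forall t, 0 < t -> a * Rpower t alpha + b * Rpower t beta + c * t = 0 -> In t L.
Proof.
  intros Ha Hb Hab.
  destruct (finite_zeros_exp a b c (beta - alpha) (1 - alpha)) as [L HL]; [easy|easy|lra|].
  exists (map exp L); intros t Ht H0.
  rewrite <- (exp_ln t) by exact Ht; apply in_map, HL.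
  apply (Rmult_eq_reg_l (Rpower t alpha));
    [|unfold Rpower; assert (P := exp_pos (alpha * ln t)); lra].
  rewrite Rmult_0_r, <- H0; unfold Rpower.
  rewrite <- (exp_ln t) at 6 by exact Ht.
  replace (beta * ln t) with (alpha * ln t + (beta - alpha) * ln t) by ring.
  replace (exp (ln t)) with (exp (alpha * ln t + (1 - alpha) * ln t)) by (f_equal; ring).
  rewrite !exp_plus; ring.
Qed.

(** * Separation of variables on one component *)

(** The component of [b] in the set where [q] is defined and nonzero, phrased through the segment on
    which [1 / q] is integrated. *)
Definition reach (Dom : R -> Prop) (q : R -> R) (b t : R) : Prop :=
  forall s, between b t s -> Dom s /\ q s <> 0.

Lemma convex_reach (Dom : R -> Prop) (q : R -> R) (b : R) : convex (reach Dom q b).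
Proof.
  intros x y z Hx Hz Hy s Hs.
  destruct (Rle_dec b y); [apply Hz|apply Hx]; minmax.
Qed.

Lemma cont_in_inv_reach (Dom : R -> Prop) (q : R -> R) (b t : R) :
  (forall s, Dom s -> ex_derive q s) -> reach Dom q b t ->
  cont_in (reach Dom q b) (fun s => / q s) t.
Proof.
  intros Hq Ht; apply cont_in_continuous, (ex_derive_continuous (V := R_NormedModule)).
  destruct (Ht t) as [Ds Qs]; [minmax|].
  apply ex_derive_inv; auto.
Qed.

Lemma reach_base (Dom : R -> Prop) (q : R -> R) (b t : R) :
  reach Dom q b t -> reach Dom q b b.
Proof. intros Ht s Hs; apply Ht; minmax. Qed.

Lemma separable_solution_iff (J Dom : R -> Prop) (g q w G : R -> R) (Z B : list R) :
  interval J -> (forall t, Dom t -> ex_derive q t) ->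
  (forall y, J y -> cont_in J g y) ->
  (forall y, J y -> has_deriv J G y (g y)) ->
  (forall y, J y -> exists l, has_deriv J w y l) ->
  (forall z, In z Z <-> Dom z /\ q z = 0) ->
  (forall t, Dom t -> q t <> 0 -> exists b, In b B /\
     reach Dom q b t) ->
  (forall y, J y -> Dom (w y) /\ has_deriv J w y (g y * q (w y))) <->
  (exists z, In z Z /\ forall y, J y -> w y = z) \/
  (exists b C, In b B /\ forall y, J y ->
     reach Dom q b (w y) /\
     RInt (fun s => / q s) b (w y) = G y + C).
Proof.
  intros HI Hq Hg HG Hw HZ HB; assert (HI' := HI); destruct HI' as [HJ Hne].
  assert (HH : forall b t, reach Dom q b t ->
            has_deriv (reach Dom q b) (fun x => RInt (fun s => / q s) b x) t (/ q t)).
  { intros b t Ht; apply (has_deriv_RInt (reach Dom q b) (fun s => / q s)).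
    - apply convex_reach.
    - intros s; now apply cont_in_inv_reach.
    - now apply (reach_base _ _ _ t).
    - exact Ht. }
  split.
  - intros Hsol.
    destruct (classic (exists a, J a /\ q (w a) = 0)) as [[a [Ja H0]]|Hn].
    + left; exists (w a); split; [apply HZ; split; [now apply Hsol|easy]|].
      now apply (equilibrium_unique J Dom g q w a).
    + right; destruct Hne as [a [_ [Ja _]]].
      assert (Hok : forall y, J y -> Dom (w y) /\ q (w y) <> 0).
      { intros y Jy; split; [now apply Hsol|]; intros H0; apply Hn; now exists y. }
      destruct (HB (w a)) as [b [Hb Hba]]; [now apply Hok|now apply Hok|].
      assert (Hb' : forall y, J y -> reach Dom q b (w y)).
      { intros y Jy s Hs.
        (* Otherwise [s] lies between [w a] and [w y], so it is a value of [w] on [J], where [q]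
           does not vanish. *)
        destruct (classic (between b (w a) s)) as [|Hnb]; [auto|].
        destruct (ivt_in J w a y s) as [t [Jt <-]]; auto.
        - intros t Jt; eapply cont_in_deriv; now apply Hsol.
        - minmax. }
      exists b, (RInt (fun s => / q s) b (w a) - G a); split; [easy|].
      intros y Jy; split; [now apply Hb'|].
      assert (E : RInt (fun s => / q s) b (w y) - G y = RInt (fun s => / q s) b (w a) - G a).
      { apply (has_deriv_zero_const J (fun y => RInt (fun s => / q s) b (w y) - G y)); auto.
        intros t Jt; destruct (Hsol t Jt) as [_ Hd].
        eapply has_deriv_eq; [|exact (has_deriv_minus _ _ _ _ _ _
          (has_deriv_comp _ _ _ _ _ _ _ Hb' Hd (HH b _ (Hb' t Jt))) (HG t Jt))].
        destruct (Hok t Jt); field; easy. }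
      lra.
  - intros [[z [Hz Hc]]|[b [C [_ Hb]]]] y Jy.
    + apply HZ in Hz as [Dz Qz]; rewrite (Hc y Jy); split; [exact Dz|].
      apply (has_deriv_ext J (fun _ => z)); [intros x Jx; now rewrite Hc|exact Jy|].
      rewrite Qz, Rmult_0_r; apply has_deriv_const.
    + assert (Hb' : forall y, J y -> reach Dom q b (w y)) by (intros x Jx; exact (proj1 (Hb x Jx))).
      destruct (Hb' y Jy (w y)) as [Dy Qy]; [minmax|]; split; [exact Dy|].
      destruct (Hw y Jy) as [l Hl].
      (* Differentiating the relation in two ways: [w] is known to have some derivative [l], and
         uniqueness of relative derivatives fixes its value. *)
      assert (E : l * / q (w y) = g y).
      { apply (has_deriv_unique J (fun y => RInt (fun s => / q s) b (w y)) y); auto.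
        - exact (has_deriv_comp _ _ _ _ _ _ _ Hb' Hl (HH b _ (Hb' y Jy))).
        - apply (has_deriv_ext J (fun x => G x + C)); [|exact Jy|].
          + intros x Jx; symmetry; now apply Hb.
          + eapply has_deriv_eq; [|exact (has_deriv_plus _ _ _ _ _ _ (HG y Jy)
              (has_deriv_const J C y))]; simpl; ring. }
      rewrite <- E; eapply has_deriv_eq; [|exact Hl]; field; exact Qy.
Qed.

(** * Real powers and the reduced right-hand side *)

Lemma rpow_pos (x a : R) : 0 < x -> rpow x a = Rpower x a.
Proof. intros H; unfold rpow; destruct Rlt_dec; easy. Qed.

Lemma rpow_IZR (x : R) (z : Z) : rpow x (IZR z) = powerRZ x z.
Proof.
  unfold rpow; destruct Rlt_dec as [H|H].
  - now rewrite powerRZ_Rpower.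
  - rewrite <- (Int_part_spec (IZR z) z) by lra; reflexivity.
Qed.

Lemma rpow_neq_0 (x a : R) : x <> 0 -> rpow x a <> 0.
Proof.
  intros H; unfold rpow; destruct Rlt_dec.
  - unfold Rpower; assert (P := exp_pos (a * ln x)); lra.
  - now apply powerRZ_NOR.
Qed.

(** Only [c] has to be positive; this is what lets [v = u w] cover zero and negative values of
    [v]. *)
Lemma rpow_mult (c x a : R) :
  0 < c -> pow_defined x a -> rpow (c * x) a = Rpower c a * rpow x a.
Proof.
  intros Hc [Hx|[z [-> _]]].
  - rewrite !rpow_pos by nra; symmetry; now apply Rpower_mult_distr.
  - rewrite !rpow_IZR, powerRZ_mult, powerRZ_Rpower; easy.
Qed.

Lemma pow_defined_mult (c x a : R) : 0 < c -> pow_defined x a -> pow_defined (c * x) a.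
Proof.
  intros Hc [Hx|[z [Hz H]]]; [left; nra|right; exists z; split; [exact Hz|]].
  destruct H as [H|H]; [left; nra|now right].
Qed.

(** For [t <= 0] the exponent is an integer, and at [t = 0] it is nonnegative, so the power is a
    monomial there. *)
Lemma ex_derive_rpow (a t : R) : pow_defined t a -> ex_derive (fun s => rpow s a) t.
Proof.
  intros [Ht|[z [-> Hz]]].
  - apply (ex_derive_ext_loc (fun s => Rpower s a)).
    + apply (filter_imp (fun s => 0 < s)); [intros s Hs; now rewrite rpow_pos|].
      now apply open_gt.
    + unfold Rpower; auto_derive; exact Ht.
  - apply (ex_derive_ext (fun s => powerRZ s z)); [intros s; now rewrite rpow_IZR|].
    destruct z as [|p|p]; simpl.
    + apply ex_derive_const.
    + auto_derive; easy.
    + destruct Hz as [Hz|Hz]; [|now destruct Hz].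
      auto_derive; now apply pow_nonzero.
Qed.

Definition abel_dom (alpha beta t : R) : Prop :=
  pow_defined t alpha /\ pow_defined t beta.

Definition abel_reduced (alpha beta e c t : R) : R :=
  rpow t alpha + (e * rpow t beta + - c * t).

Lemma abel_dom_mult (alpha beta c t : R) :
  0 < c -> abel_dom alpha beta t -> abel_dom alpha beta (c * t).
Proof. intros Hc [Ha Hb]; split; now apply pow_defined_mult. Qed.

(** To the right of a point of the domain, only [0] can be missing: it is excluded by negative
    integer exponents. *)
Lemma abel_dom_lt (alpha beta s t : R) :
  abel_dom alpha beta s -> s < t -> t <> 0 -> abel_dom alpha beta t.
Proof.
  assert (H : forall a, pow_defined s a -> s < t -> t <> 0 -> pow_defined t a).
  { intros a [Hs|[z [Hz _]]] Hst Ht; [left; lra|right; exists z; auto]. }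
  intros [Ha Hb]; split; auto.
Qed.

Lemma ex_derive_abel_reduced (alpha beta e c t : R) :
  abel_dom alpha beta t -> ex_derive (abel_reduced alpha beta e c) t.
Proof.
  intros [Ha Hb].
  apply (ex_derive_plus (V := R_NormedModule)); [now apply ex_derive_rpow|].
  apply (ex_derive_plus (V := R_NormedModule)).
  - apply ex_derive_scal; now apply ex_derive_rpow.
  - auto_derive; easy.
Qed.

(** For negative [t], writing [t = (- t) * -1] turns the powers into powers of [- t > 0] with
    coefficients involving [rpow (-1)], and flips the sign of the linear term. The point [0] is
    listed by hand. *)
Lemma finite_zeros_abel_reduced (alpha beta e c : R) :
  alpha <> beta -> e <> 0 ->
  exists L, forall t, abel_dom alpha beta t -> abel_reduced alpha beta e c t = 0 -> In t L.
Proof.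
  intros Hab He.
  destruct (finite_zeros_Rpower 1 e (- c) alpha beta) as [Lp Hp]; [lra|easy|easy|].
  destruct (finite_zeros_Rpower (rpow (-1) alpha) (e * rpow (-1) beta) c alpha beta)
    as [Ln Hn]; [apply rpow_neq_0; lra| |easy|].
  { apply Rmult_integral_contrapositive_currified; [easy|apply rpow_neq_0; lra]. }
  exists (0 :: Lp ++ map Ropp Ln); intros t Dt Qt; unfold abel_reduced in Qt.
  destruct (Rtotal_order t 0) as [L|[->|L]]; [right|now left|right].
  - apply in_or_app; right; rewrite <- (Ropp_involutive t); apply in_map, Hn; [lra|].
    (* [-1] is in the domain, being [t] rescaled by the positive number [/ - t]. *)
    destruct (abel_dom_mult alpha beta (/ - t) t) as [Da Db]; [|exact Dt|].
    { apply Rinv_0_lt_compat; lra. }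
    replace (/ - t * t) with (-1) in Da, Db by (field; lra).
    replace t with (- t * -1) in Qt by ring.
    rewrite !rpow_mult in Qt by (easy || lra).
    rewrite <- Qt; ring.
  - apply in_or_app; left; apply Hp; [exact L|].
    rewrite !rpow_pos in Qt by exact L; rewrite <- Qt; ring.
Qed.

(** Moving right from an admissible point, the only possible obstacles are [0] and the zeros of [q];
    those among them that are not admissible form the finite separating set [Z']. A point between
    [b] and [t] is reached from the smaller of the two. *)
Lemma reach_finite_representatives (alpha beta e c : R) (Z : list R) :
  (forall z, In z Z <-> abel_dom alpha beta z /\ abel_reduced alpha beta e c z = 0) ->
  exists B, forall t, abel_dom alpha beta t -> abel_reduced alpha beta e c t <> 0 ->
    exists b, In b B /\ reach (abel_dom alpha beta) (abel_reduced alpha beta e c) b t.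
Proof.
  intros HZ.
  set (ok := fun t => abel_dom alpha beta t /\ abel_reduced alpha beta e c t <> 0).
  destruct (finite_sub (fun t => In t (0 :: Z) /\ ~ ok t) (0 :: Z)) as [Z' HZ']; [tauto|].
  destruct (finite_representatives Z' ok) as [B [HB H]].
  assert (Hlt : forall s t, ok s -> s < t -> ~ In t Z' -> ok t).
  { intros s t Hs Hst Hn; apply NNPP; intros Ht; apply Hn, HZ'; split; [|exact Ht].
    destruct (Req_dec t 0) as [->|H0]; [now left|right].
    apply HZ; assert (Dt : abel_dom alpha beta t) by now apply (abel_dom_lt _ _ s); try apply Hs.
    split; [exact Dt|]; apply NNPP; intros Hq; now apply Ht. }
  exists B; intros t Dt Qt; destruct (H t) as [b [Hb Hs]]; [easy| |].
  - intros Hin; apply HZ' in Hin; now apply Hin.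
  - exists b; split; [exact Hb|]; intros s Hbs.
    destruct (Req_dec s b) as [->|Hsb]; [now apply HB|].
    destruct (Req_dec s t) as [->|Hst]; [easy|].
    assert (Hn : ~ In s Z') by (intros Hin; exact (Hs s Hin Hbs)).
    destruct (Rle_dec b t).
    + apply (Hlt b); [now apply HB|minmax|exact Hn].
    + apply (Hlt t); [easy|minmax|exact Hn].
Qed.

Lemma Rpower_inv_exponent (r a : R) : 0 < r -> a <> 0 -> Rpower (Rpower r (1 / a)) a = r.
Proof.
  intros Hr Ha; rewrite Rpower_mult; replace (1 / a * a) with 1 by (field; exact Ha).
  now apply Rpower_1.
Qed.

Lemma abel_scaling (alpha beta e u w f k : R) :
  e * e = 1 -> 0 < u -> k <> 0 -> abel_dom alpha beta w ->
  Rpower u (beta - alpha) = e * (f / k) ->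
  f * rpow (u * w) alpha + k * rpow (u * w) beta =
  f * Rpower u alpha * (rpow w alpha + e * rpow w beta).
Proof.
  intros He Hu Hk [Ha Hb] E; rewrite !rpow_mult by assumption.
  replace (Rpower u beta) with (Rpower u (beta - alpha) * Rpower u alpha)
    by (rewrite <- Rpower_plus; f_equal; ring).
  rewrite E; field; exact Hk.
Qed.

Lemma constant_sign (J : R -> Prop) (h : R -> R) :
  convex J -> (forall y, J y -> cont_in J h y) -> (forall y, J y -> h y <> 0) ->
  exists e, e * e = 1 /\ forall y, J y -> 0 < e * h y.
Proof.
  intros HJ Hc H0.
  assert (Hno : forall a b, J a -> J b -> h a < 0 -> 0 < h b -> False).
  { intros a b Ja Jb Ha Hb.
    destruct (ivt_in J h a b 0) as [t [Jt Ht]]; auto; [minmax|].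
    now apply (H0 t). }
  destruct (classic (exists a, J a /\ h a < 0)) as [[a [Ja Ha]]|Hn].
  - exists (-1); split; [ring|]; intros y Jy.
    destruct (Rtotal_order (h y) 0) as [L|[L|L]]; [lra|now apply H0 in L|].
    now destruct (Hno a y).
  - exists 1; split; [ring|]; intros y Jy.
    destruct (Rtotal_order (h y) 0) as [L|[L|L]]; [|now apply H0 in L|lra].
    destruct Hn; now exists y.
Qed.

(** For [f / k < 0] the powers in the hypothesis have integer exponents, and
    differ from those of [|f / k|] by constant signs only. *)
Lemma scale_deriv (alpha beta s e : R) (I : R -> Prop) (f k : R -> R) :
  alpha <> beta -> e * e = 1 ->
  (forall y, I y -> k y <> 0) ->
  (forall y, I y -> 0 < e * (f y / k y)) ->
  (forall y, I y -> pow_defined (f y / k y) (1 / (beta - alpha))) ->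
  (forall y, I y ->
     pow_defined (f y / k y) (alpha / (beta - alpha)) /\
     has_deriv I (fun z => rpow (f z / k z) (1 / (beta - alpha))) y
       (s * f y * rpow (f y / k y) (alpha / (beta - alpha))))
  \/
  (forall y, I y ->
     pow_defined (f y / k y) (beta / (beta - alpha)) /\
     has_deriv I (fun z => rpow (f z / k z) (1 / (beta - alpha))) y
       (s * k y * rpow (f y / k y) (beta / (beta - alpha)))) ->
  exists c, forall y, I y ->
    has_deriv I (fun z => Rpower (e * (f z / k z)) (1 / (beta - alpha))) y
      (c * f y * Rpower (Rpower (e * (f y / k y)) (1 / (beta - alpha))) alpha).
Proof.
  intros Hab He Hk Hr Hu Hc.
  (* With [r = f y / k y], [r = (e * r) * e] and [e * r > 0], so the constant [rpow e a] splits off.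
     The power of [e] is defined because [e] is [r] rescaled by the positive number [/ (e * r)]. *)
  assert (Hs : forall a y, I y -> pow_defined (f y / k y) a ->
    rpow (f y / k y) a = Rpower (e * (f y / k y)) a * rpow e a).
  { intros a y Iy Hp; rewrite <- rpow_mult; [f_equal|now apply Hr|].
    - transitivity (e * e * (f y / k y)); [rewrite He|]; ring.
    - assert (H := pow_defined_mult _ _ _ (Rinv_0_lt_compat _ (Hr y Iy)) Hp).
      assert (P := Hr y Iy).
      replace e with (/ (e * (f y / k y)) * (f y / k y)); [exact H|].
      set (x := f y / k y) in *.
      apply (Rmult_eq_reg_l (e * x)); [|lra].
      rewrite <- Rmult_assoc, Rinv_r by lra.
      transitivity (e * e * x); [rewrite He|]; ring. }
  assert (He0 : e <> 0) by (intros ->; lra).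
  set (sg := rpow e (1 / (beta - alpha))).
  assert (Hsg : sg <> 0) by now apply rpow_neq_0.
  assert (Hpow : forall a y,
    Rpower (e * (f y / k y)) (a / (beta - alpha)) =
    Rpower (Rpower (e * (f y / k y)) (1 / (beta - alpha))) a).
  { intros a y; rewrite Rpower_mult; f_equal; field; lra. }
  assert (HU : forall y l, I y ->
    has_deriv I (fun z => rpow (f z / k z) (1 / (beta - alpha))) y l ->
    has_deriv I (fun z => Rpower (e * (f z / k z)) (1 / (beta - alpha))) y (l / sg)).
  { intros y l Iy H.
    apply (has_deriv_ext I (fun z => rpow (f z / k z) (1 / (beta - alpha)) / sg)); [|exact Iy|].
    - intros z Iz; rewrite Hs by auto; fold sg; field; exact Hsg.
    - eapply has_deriv_eq; [|exact (has_deriv_div _ _ (fun _ => sg) _ _ _ Hsg H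
        (has_deriv_const I sg y))]; simpl; unfold Rsqr; field; exact Hsg. }
  destruct Hc as [Hc|Hc].
  - exists (s * rpow e (alpha / (beta - alpha)) / sg); intros y Iy.
    destruct (Hc y Iy) as [Hp Hd].
    eapply has_deriv_eq; [|exact (HU y _ Iy Hd)].
    rewrite Hs, Hpow by auto; field; exact Hsg.
  (* The extra factor [e] comes from [k u^beta = e f u^alpha], which brings the second condition to
     the form of the first. *)
  - exists (s * rpow e (beta / (beta - alpha)) * e / sg); intros y Iy.
    destruct (Hc y Iy) as [Hp Hd].
    eapply has_deriv_eq; [|exact (HU y _ Iy Hd)].
    rewrite Hs, Hpow by auto.
    set (u := Rpower (e * (f y / k y)) (1 / (beta - alpha))).
    replace (Rpower u beta) with (Rpower u (beta - alpha) * Rpower u alpha)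
      by (rewrite <- Rpower_plus; f_equal; ring).
    unfold u at 1; rewrite Rpower_inv_exponent; [|now apply Hr|lra].
    field; auto.
Qed.

(** * Formulas in quadratures *)

(** Lets the witnesses hidden in a given denotation be identified with known values. In the case of
    [QInt] the integrand is determined only on the path, which suffices for the integral. *)
Lemma qdenotes_fun (I : R -> Prop) (K : list (R -> R)) (e : qexp) :
  forall rho x x', qdenotes I K e rho x -> qdenotes I K e rho x' -> x = x'.
Proof.
  induction e; simpl; intros rho x x' H H'.
  - congruence.
  - congruence.
  - destruct H as (g & x1 & Hg & H1 & _ & ->), H' as (g' & x1' & Hg' & H1' & _ & ->).
    rewrite (IHe _ _ _ H1 H1'); congruence.
  - destruct H as (x1 & x2 & H1 & H2 & ->), H' as (x1' & x2' & H1' & H2' & ->).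
    now rewrite (IHe1 _ _ _ H1 H1'), (IHe2 _ _ _ H2 H2').
  - destruct H as (x1 & x2 & H1 & H2 & ->), H' as (x1' & x2' & H1' & H2' & ->).
    now rewrite (IHe1 _ _ _ H1 H1'), (IHe2 _ _ _ H2 H2').
  - destruct H as (x1 & H1 & _ & ->), H' as (x1' & H1' & _ & ->).
    now rewrite (IHe _ _ _ H1 H1').
  - destruct H as (x1 & H1 & _ & ->), H' as (x1' & H1' & _ & ->).
    now rewrite (IHe _ _ _ H1 H1').
  - destruct H as (x1 & H1 & ->), H' as (x1' & H1' & ->).
    now rewrite (IHe _ _ _ H1 H1').
  - destruct H as (x1 & H1 & _ & ->), H' as (x1' & H1' & _ & ->).
    now rewrite (IHe _ _ _ H1 H1').
  - destruct H as (x1 & H1 & ->), H' as (x1' & H1' & ->).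
    now rewrite (IHe _ _ _ H1 H1').
  - destruct H as (x1 & H1 & ->), H' as (x1' & H1' & ->).
    now rewrite (IHe _ _ _ H1 H1').
  - destruct H as (a & b & h & Ha & Hb & Hh & Hx), H' as (a' & b' & h' & Ha' & Hb' & Hh' & Hx').
    assert (a' = a) as -> by eauto; assert (b' = b) as -> by eauto.
    rewrite <- (is_RInt_unique _ _ _ _ Hx); apply is_RInt_unique.
    apply (is_RInt_ext h'); [|exact Hx'].
    intros t Ht; apply (IHe3 (env_cons t rho)); [apply Hh'|apply Hh]; lra.
Qed.

(** In the final formulas the variables [0], [1], [2] are [y], [v], [C], and the coefficients [0],
    [1] are [f], [k]. Under [QInt] the variable [0] is the integration variable, so [scale_exp] is
    read at [y] in [ratio_exp] and at the integration variable in [speed_exp]. *)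
Definition scale_exp (alpha beta e : R) : qexp :=
  QPow (QMul (QConst e) (QMul (QCoef 0 (QVar 0)) (QInv (QCoef 1 (QVar 0)))))
       (1 / (beta - alpha)).

Definition scale (alpha beta e : R) (f k : R -> R) (y : R) : R :=
  Rpower (e * (f y / k y)) (1 / (beta - alpha)).

Definition speed_exp (alpha beta e : R) : qexp :=
  QMul (QCoef 0 (QVar 0)) (QPow (scale_exp alpha beta e) (alpha - 1)).

Definition speed (alpha beta e : R) (f k : R -> R) (y : R) : R :=
  f y * Rpower (scale alpha beta e f k y) (alpha - 1).

Definition abel_reduced_exp (alpha beta e c : R) : qexp :=
  QAdd (QPow (QVar 0) alpha)
       (QAdd (QMul (QConst e) (QPow (QVar 0) beta)) (QMul (QConst (- c)) (QVar 0))).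

Definition ratio_exp (alpha beta e : R) : qexp :=
  QMul (QVar 1) (QInv (scale_exp alpha beta e)).

Definition equilibrium_exp (alpha beta e z : R) : qexp :=
  QAdd (ratio_exp alpha beta e) (QConst (- z)).

Definition quadrature_exp (alpha beta e c a b : R) : qexp :=
  QAdd (QInt (QConst b) (ratio_exp alpha beta e) (QInv (abel_reduced_exp alpha beta e c)))
       (QMul (QConst (-1))
          (QAdd (QInt (QConst a) (QVar 0) (speed_exp alpha beta e)) (QVar 2))).

Lemma scale_pos (alpha beta e : R) (f k : R -> R) (y : R) : 0 < scale alpha beta e f k y.
Proof. apply exp_pos. Qed.

Lemma abel_reduced_exp_denotes (alpha beta e c : R) (I : R -> Prop) (K : list (R -> R))
    (rho : nat -> R) (x : R) :
  qdenotes I K (abel_reduced_exp alpha beta e c) rho x <->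
  abel_dom alpha beta (rho O) /\ x = abel_reduced alpha beta e c (rho O).
Proof.
  unfold abel_dom, abel_reduced; simpl; split.
  - intros (x1 & x2 & (t & -> & Da & ->) & (x3 & x4 & (x5 & x6 & -> & (t' & -> & Db & ->) & ->)
      & (x7 & x8 & -> & -> & ->) & ->) & ->); auto.
  - intros [[Da Db] ->].
    exists (rpow (rho O) alpha), (e * rpow (rho O) beta + - c * rho O).
    split; [now exists (rho O)|split; [|reflexivity]].
    exists (e * rpow (rho O) beta), (- c * rho O).
    split; [|split; [now exists (- c), (rho O)|reflexivity]].
    exists e, (rpow (rho O) beta); split; [easy|split; [|easy]]; now exists (rho O).
Qed.

Lemma scale_exp_denotes (alpha beta e : R) (I : R -> Prop) (f k : R -> R) (rho : nat -> R) :
  I (rho O) -> k (rho O) <> 0 -> 0 < e * (f (rho O) / k (rho O)) ->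
  qdenotes I [f; k] (scale_exp alpha beta e) rho (scale alpha beta e f k (rho O)).
Proof.
  intros Iy Hk Hr; simpl.
  exists (e * (f (rho O) / k (rho O))); split; [|split; [now left|now rewrite rpow_pos]].
  exists e, (f (rho O) / k (rho O)); split; [easy|split; [|easy]].
  exists (f (rho O)), (/ k (rho O)); split; [now exists f, (rho O)|split; [|easy]].
  exists (k (rho O)); split; [now exists k, (rho O)|easy].
Qed.

Lemma ratio_exp_denotes (alpha beta e : R) (I : R -> Prop) (f k : R -> R) (rho : nat -> R) :
  I (rho O) -> k (rho O) <> 0 -> 0 < e * (f (rho O) / k (rho O)) ->
  qdenotes I [f; k] (ratio_exp alpha beta e) rho
    (rho 1%nat / scale alpha beta e f k (rho O)).
Proof.
  intros Iy Hk Hr.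
  assert (P := scale_pos alpha beta e f k (rho O)).
  exists (rho 1%nat), (/ scale alpha beta e f k (rho O)); split; [reflexivity|split; [|reflexivity]].
  exists (scale alpha beta e f k (rho O)); split; [now apply scale_exp_denotes|].
  split; [lra|reflexivity].
Qed.

Lemma speed_exp_denotes (alpha beta e : R) (I : R -> Prop) (f k : R -> R) (rho : nat -> R) :
  I (rho O) -> k (rho O) <> 0 -> 0 < e * (f (rho O) / k (rho O)) ->
  qdenotes I [f; k] (speed_exp alpha beta e) rho (speed alpha beta e f k (rho O)).
Proof.
  intros Iy Hk Hr.
  assert (P := scale_pos alpha beta e f k (rho O)).
  exists (f (rho O)), (Rpower (scale alpha beta e f k (rho O)) (alpha - 1)).
  split; [now exists f, (rho O)|split; [|reflexivity]].
  exists (scale alpha beta e f k (rho O)); split; [now apply scale_exp_denotes|].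
  split; [now left|now rewrite rpow_pos].
Qed.

Lemma equilibrium_exp_denotes (alpha beta e z : R) (I : R -> Prop) (f k : R -> R)
    (rho : nat -> R) :
  I (rho O) -> k (rho O) <> 0 -> 0 < e * (f (rho O) / k (rho O)) ->
  qdenotes I [f; k] (equilibrium_exp alpha beta e z) rho 0 <->
  rho 1%nat / scale alpha beta e f k (rho O) = z.
Proof.
  intros Iy Hk Hr; assert (Hd := ratio_exp_denotes alpha beta e I f k rho Iy Hk Hr).
  split.
  - intros (x1 & x2 & H1 & H2 & H0); simpl in H2.
    rewrite (qdenotes_fun _ _ _ _ _ _ Hd H1); lra.
  - intros E; exists (rho 1%nat / scale alpha beta e f k (rho O)), (- z).
    split; [exact Hd|split; [reflexivity|rewrite E; ring]].
Qed.

(** The definedness of [1 / q] on the path of integration is what keeps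
    [v / scale] in the component of the base point [b]. *)
Lemma quadrature_exp_denotes (alpha beta e c a b : R) (I : R -> Prop) (f k : R -> R)
    (rho : nat -> R) :
  convex I -> I a -> I (rho O) ->
  (forall y, I y -> k y <> 0) -> (forall y, I y -> 0 < e * (f y / k y)) ->
  (forall y, I y -> cont_in I (speed alpha beta e f k) y) ->
  let q := abel_reduced alpha beta e c in
  let w := rho 1%nat / scale alpha beta e f k (rho O) in
  qdenotes I [f; k] (quadrature_exp alpha beta e c a b) rho 0 <->
  reach (abel_dom alpha beta) q b w /\
  RInt (fun s => / q s) b w = RInt (speed alpha beta e f k) a (rho O) + rho 2%nat.
Proof.
  intros HI Ia Iy Hk Hr Hg q w.
  assert (Hw : qdenotes I [f; k] (ratio_exp alpha beta e) rho w)
    by (apply ratio_exp_denotes; auto).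
  assert (HG : qdenotes I [f; k] (QInt (QConst a) (QVar 0) (speed_exp alpha beta e)) rho
                 (RInt (speed alpha beta e f k) a (rho O))).
  { exists a, (rho O), (speed alpha beta e f k).
    split; [reflexivity|split; [reflexivity|split]].
    - intros t Ht; assert (It : I t) by now apply (convex_between I a (rho O)).
      apply (speed_exp_denotes alpha beta e I f k (env_cons t rho)); simpl; auto.
    - now apply (is_RInt_cont_in I). }
  split.
  - intros (x1 & x2 & (b' & w' & h & Hb & Hw' & Hh & Hx) & (m & x3 & Hm & (x4 & x5 & H4 & H5 & ->)
      & ->) & H0).
    simpl in Hb, Hm, H5; subst b' m x5.
    rewrite <- (qdenotes_fun _ _ _ _ _ _ Hw Hw') in Hh, Hx.
    rewrite <- (qdenotes_fun _ _ _ _ _ _ HG H4) in H0.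
    assert (Hq : forall t, between b w t ->
              (abel_dom alpha beta t /\ q t <> 0) /\ h t = / q t).
    { intros t Ht; destruct (Hh t Ht) as (x & Hx' & Hne & ->).
      apply abel_reduced_exp_denotes in Hx' as [Dt ->]; auto. }
    split; [intros t Ht; now apply Hq|].
    assert (E : RInt (fun s => / q s) b w = x1); [|lra].
    apply is_RInt_unique, (is_RInt_ext h); [|exact Hx].
    intros t Ht; apply Hq; unfold between; lra.
  - intros [HR E].
    exists (RInt (fun s => / q s) b w),
      (-1 * (RInt (speed alpha beta e f k) a (rho O) + rho 2%nat)).
    split; [|split; [|lra]].
    + exists b, w, (fun s => / q s); split; [reflexivity|split; [exact Hw|split]].
      * intros t Ht; destruct (HR t Ht) as [Dt Qt].
        exists (q t); split; [now apply abel_reduced_exp_denotes|easy].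
      * apply (is_RInt_cont_in (reach (abel_dom alpha beta) q b)).
        -- apply convex_reach.
        -- intros t; apply cont_in_inv_reach; intros s; apply ex_derive_abel_reduced.
        -- now apply (reach_base _ _ _ w).
        -- exact HR.
    + exists (-1), (RInt (speed alpha beta e f k) a (rho O) + rho 2%nat).
      split; [reflexivity|split; [|reflexivity]].
      exists (RInt (speed alpha beta e f k) a (rho O)), (rho 2%nat); split; [exact HG|easy].
Qed.

(** * The substitution [v = u w] and the general solution *)

(** The quotient rule for [v / u] gives one direction, the product rule for [u * (v / u)] the other;
    the term [- c * w] of [q] is the contribution of [u']. *)
Lemma reduced_deriv_iff (alpha beta e c : R) (J : R -> Prop) (u v : R -> R) (y f k : R) :
  e * e = 1 -> k <> 0 -> J y -> (forall x, J x -> 0 < u x) ->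
  Rpower (u y) (beta - alpha) = e * (f / k) ->
  has_deriv J u y (c * f * Rpower (u y) alpha) ->
  (abel_dom alpha beta (v y) /\ has_deriv J v y (f * rpow (v y) alpha + k * rpow (v y) beta))
  <->
  (abel_dom alpha beta (v y / u y) /\
   has_deriv J (fun x => v x / u x) y
     (f * Rpower (u y) (alpha - 1) * abel_reduced alpha beta e c (v y / u y))).
Proof.
  intros He Hk Jy Hu E Hd.
  assert (Hv : forall x, J x -> v x = u x * (v x / u x)).
  { intros x Jx; assert (P := Hu x Jx); field; lra. }
  assert (P := Hu y Jy).
  assert (Hpow : Rpower (u y) (alpha - 1) = Rpower (u y) alpha / u y).
  { apply (Rmult_eq_reg_r (u y)); [|lra].
    rewrite <- (Rpower_1 (u y)) at 2 by exact P.
    rewrite <- Rpower_plus; replace (alpha - 1 + 1) with alpha by ring; field; lra. }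
  assert (Hdom : abel_dom alpha beta (v y) <-> abel_dom alpha beta (v y / u y)).
  { split; intros H.
    - unfold Rdiv; rewrite Rmult_comm; apply abel_dom_mult; [|exact H].
      now apply Rinv_0_lt_compat.
    - rewrite (Hv y Jy); now apply abel_dom_mult. }
  assert (Hval : abel_dom alpha beta (v y / u y) ->
    f * rpow (v y) alpha + k * rpow (v y) beta =
    f * Rpower (u y) alpha * (rpow (v y / u y) alpha + e * rpow (v y / u y) beta)).
  { intros H; rewrite (Hv y Jy) at 1 2; now apply abel_scaling. }
  rewrite Hpow; unfold abel_reduced; split; intros [D H]; (split; [now apply Hdom|]).
  - rewrite Hval in H by now apply Hdom.
    eapply has_deriv_eq; [|apply (has_deriv_div _ _ _ _ _ _ (Rgt_not_eq _ _ P) H Hd)].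
    unfold Rsqr; field; lra.
  - rewrite Hval by exact D.
    apply (has_deriv_ext J (fun x => u x * (v x / u x))); [|exact Jy|].
    + intros x Jx; now rewrite <- Hv.
    + eapply has_deriv_eq; [|exact (has_deriv_mult _ _ _ _ _ _ Hd H)]; simpl; field; lra.
Qed.

Theorem lemma2 (alpha beta S P : R) (I : R -> Prop) (f k : R -> R)
  (h_ab : alpha <> beta)
  (h_I : interval I)
  (h_f : smooth_on I f) (h_k : smooth_on I k)
  (h_f0 : forall y, I y -> f y <> 0) (h_k0 : forall y, I y -> k y <> 0)
  (h_P : pow_defined P (beta - 1))
  (h_u : forall y, I y -> pow_defined (f y / k y) (1 / (beta - alpha)))
  (h_cond :
    (forall y, I y ->
       pow_defined (f y / k y) (alpha / (beta - alpha)) /\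
       D_in (fun z => rpow (f z / k z) (1 / (beta - alpha)))
            (fun z => S * rpow P (beta - 1) * f z
                      * rpow (f z / k z) (alpha / (beta - alpha))) I y)
    \/
    (forall y, I y ->
       pow_defined (f y / k y) (beta / (beta - alpha)) /\
       D_in (fun z => rpow (f z / k z) (1 / (beta - alpha)))
            (fun z => S * rpow P (beta - 1) * k z
                      * rpow (f z / k z) (beta / (beta - alpha))) I y)) :
  exactly_integrable I [f; k]
    (fun _ v => pow_defined v alpha /\ pow_defined v beta)
    (fun y v => f y * rpow v alpha + k y * rpow v beta).
Proof.
  destruct h_I as [HI [a [_ [Ia _]]]].
  assert (Hsm : forall h, smooth_on I h -> forall y, I y -> exists l, has_deriv I h y l).
  { intros h [G [G0 GS]] y Iy; exists (G 1%nat y).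
    exact (has_deriv_ext I (G O) h y _ G0 Iy (GS O y Iy)). }
  assert (Hfk : forall y, I y -> cont_in I (fun x => f x / k x) y).
  { intros y Iy; destruct (Hsm f h_f y Iy) as [lf Hf], (Hsm k h_k y Iy) as [lk Hk].
    eapply cont_in_deriv, has_deriv_div; eauto. }
  destruct (constant_sign I (fun x => f x / k x) HI Hfk) as [e [He Hr]].
  { intros y Iy; apply Rmult_integral_contrapositive_currified; [auto|].
    apply Rinv_neq_0_compat; auto. }
  destruct (scale_deriv alpha beta (S * rpow P (beta - 1)) e I f k) as [c HU]; auto.
  set (u := scale alpha beta e f k).
  set (q := abel_reduced alpha beta e c).
  set (g := speed alpha beta e f k).
  assert (Hup : forall y, 0 < u y) by apply scale_pos.
  assert (Hg : forall y, I y -> cont_in I g y).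
  { intros y Iy; destruct (Hsm f h_f y Iy) as [lf Hf].
    apply cont_in_mult; [exact (cont_in_deriv _ _ _ _ Hf)|].
    apply (cont_in_comp I u (fun x => Rpower x (alpha - 1))).
    - exact (cont_in_deriv _ _ _ _ (HU y Iy)).
    - apply (ex_derive_continuous (V := R_NormedModule)); unfold Rpower; auto_derive; apply Hup. }
  assert (He0 : e <> 0) by (intros ->; lra).
  destruct (finite_zeros_abel_reduced alpha beta e c h_ab He0) as [Z0 HZ0].
  destruct (finite_sub (fun z => abel_dom alpha beta z /\ q z = 0) Z0) as [Z HZ];
    [intros t [Dt Qt]; now apply HZ0|].
  destruct (reach_finite_representatives alpha beta e c Z HZ) as [B HB].
  (* One formula per zero of [q] and one per component; all integrals of [g] start at the same point
     [a] of [I], which need not belong to [J]. *)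
  exists (map (equilibrium_exp alpha beta e) Z ++ map (quadrature_exp alpha beta e c a) B).
  intros J v HJ HJI [v' Hv].
  assert (Hsep := separable_solution_iff J (abel_dom alpha beta) g q (fun y => v y / u y)
    (fun y => RInt g a y) Z B HJ).
  assert (Hsol : is_solution (fun _ v => pow_defined v alpha /\ pow_defined v beta)
      (fun y v => f y * rpow v alpha + k y * rpow v beta) J v <->
    forall y, J y -> abel_dom alpha beta (v y / u y) /\
      has_deriv J (fun x => v x / u x) y (g y * q (v y / u y))).
  { assert (Hba : beta - alpha <> 0) by lra.
    assert (Hiff := fun y (Jy : J y) => reduced_deriv_iff alpha beta e c J u v y (f y) (k y) He
      (h_k0 y (HJI y Jy)) Jy (fun x _ => Hup x)
      (Rpower_inv_exponent _ _ (Hr y (HJI y Jy)) Hba)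
      (has_deriv_sub _ _ _ _ _ HJI (HU y (HJI y Jy)))).
    split; intros H y Jy; apply Hiff; auto; exact (H y Jy). }
  rewrite Hsol, Hsep; clear Hsol Hsep.
  - split.
    + intros [[z [Hz H]]|[b [C [Hb H]]]].
      * exists (equilibrium_exp alpha beta e z), 0.
        split; [apply in_or_app; left; now apply in_map|].
        intros y Jy; apply equilibrium_exp_denotes; simpl; auto.
      * exists (quadrature_exp alpha beta e c a b), C.
        split; [apply in_or_app; right; now apply in_map|].
        intros y Jy; apply quadrature_exp_denotes; simpl; auto.
    + intros (E & C & HE & H); apply in_app_or in HE as [HE|HE];
        apply in_map_iff in HE as [z [<- Hz]]; [left|right].
      * exists z; split; [exact Hz|]; intros y Jy.
        specialize (H y Jy); apply equilibrium_exp_denotes in H; simpl; auto.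
      * exists z, C; split; [exact Hz|]; intros y Jy.
        specialize (H y Jy); apply quadrature_exp_denotes in H; simpl; auto.
  - intros t; apply ex_derive_abel_reduced.
  - intros y Jy; apply cont_in_iff; intros eps Heps.
    destruct (proj1 (cont_in_iff _ _ _) (Hg y (HJI y Jy)) eps Heps) as [d [Hd Hx]].
    exists d; auto.
  - intros y Jy; apply (has_deriv_sub J I); [exact HJI|].
    apply has_deriv_RInt; auto.
  - intros y Jy; eexists; apply has_deriv_div.
    + apply Rgt_not_eq, Hup.
    + exact (Hv y Jy).
    + exact (has_deriv_sub _ _ _ _ _ HJI (HU y (HJI y Jy))).
  - exact HZ.
  - exact HB.
Qed.
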